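(* There is an absolute constant $C>0$ such that for every integer $n \geq 2$ and every $\alpha \in [0,1]$, if $\mathcal{A}$ is a random set in $\mathcal{B}(n,\alpha)$ and $X := \deg \operatorname{lcm}\big([\mathcal{A}]_q\big)$, then \[ \left| \mathbb{E}[X] - \frac{3}{\pi^2}\cdot \frac{\alpha\, \mathrm{Li}_2(1-\alpha)}{1-\alpha}\cdot n^2 \right| \leq C\, \alpha n (\log n)^2 , \] where $\mathrm{Li}_2(z) := \sum_{k=1}^\infty z^k/k^2$ is the dilogarithm and the factor $\frac{\alpha\, \mathrm{Li}_2(1-\alpha)}{1-\alpha}$ is interpreted as $1$ when $\alpha = 1$. In particular, $\mathbb{E}[X] \sim \frac{3}{\pi^2}\cdot \frac{\alpha\, \mathrm{Li}_2(1-\alpha)}{1-\alpha}\cdot n^2$ as $n \to +\infty$, uniformly for $\alpha \in (0,1]$.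
   Context: For a positive integer $n$ and $\alpha\in[0,1]$, $\mathcal{B}(n,\alpha)$ denotes the probabilistic model in which a random set $\mathcal{A}\subseteq\{1,\dots,n\}$ is constructed by including each element of $\{1,\dots,n\}$ independently with probability $\alpha$. For an indeterminate $q$ and a positive integer $k$, $[k]_q := 1+q+\cdots+q^{k-1}\in\mathbb{Z}[q]$, and for a set $\mathcal{S}$ of positive integers $[\mathcal{S}]_q := \{[k]_q : k\in\mathcal{S}\}$. The least common multiple is taken in $\mathbb{Q}[q]$ (monic), with $\operatorname{lcm}(\varnothing)=1$ of degree $0$. *)

(* Defs.v *)
From HB Require Import structures.
From mathcomp Require Import all_boot all_order all_algebra.
From mathcomp Require Import all_classical all_reals all_analysis.
Set Implicit Arguments. Unset Strict Implicit. Unset Printing Implicit Defensive.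
Import Order.TTheory GRing.Theory Num.Theory.
Local Open Scope ring_scope.

Definition qint (k : nat) : {poly rat} := \sum_(i < k) 'X^i.

(* monic least common multiple of two polynomials in Q[q] (lcm 0 _ = 0) *)
Definition lcmpoly (p r : {poly rat}) : {poly rat} :=
  let l := (p * r) %/ gcdp p r in (lead_coef l)^-1 *: l.

Definition lcm_seq (s : seq {poly rat}) : {poly rat} := foldr lcmpoly 1 s.

(* A subset of {1,...,n} is encoded as a set of 'I_n, i : 'I_n standing for i+1.
   deg lcm([A]_q) *)
Definition deg_lcm_q (n : nat) (A : {set 'I_n}) : nat :=
  (size (lcm_seq [seq qint (val i).+1 | i <- enum A])).-1.

Definition expected_deg_lcm (R : realType) (n : nat) (alpha : R) : R :=
  \sum_(A : {set 'I_n}) alpha ^+ #|A| * (1 - alpha) ^+ (n - #|A|) * (deg_lcm_q A)%:R.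

Definition Li2 (R : realType) (z : R) : R :=
  limn (fun N : nat => \sum_(1 <= k < N) z ^+ k / (k%:R) ^+ 2).

Definition dens_factor (R : realType) (alpha : R) : R :=
  if alpha == 1 then 1 else alpha * Li2 (1 - alpha) / (1 - alpha).

(* Main.v *)
Require Import Defs.
From HB Require Import structures.
From mathcomp Require Import all_boot all_order all_algebra.
From mathcomp Require Import all_fingroup all_solvable all_field.
From mathcomp Require Import all_classical all_reals all_analysis.
From mathcomp Require Import ring lra.
Set Implicit Arguments. Unset Strict Implicit. Unset Printing Implicit Defensive.
Import Order.TTheory GRing.Theory Num.Theory.
Local Open Scope ring_scope.

(** Since [k]_q is the product of the cyclotomic polynomials Phi_d over the
    divisors d > 1 of k, and distinct Phi_d are coprime, deg lcm([A]_q) is the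
    sum of phi(d) over the d > 1 dividing some element of A.  Such a d occurs
    with probability 1 - (1 - alpha)^(n/d), rounding n/d down.  Adding the term
    d = 1, expanding 1 - z^k = alpha (1 + z + ... + z^(k-1)) for z = 1 - alpha,
    and exchanging sums turns the expectation into
    alpha * sum_(1 <= j <= n) z^(j-1) Phi(n/j), where Phi is the summatory
    function of phi.  The classical estimate Phi(x) = 3/pi^2 x^2 + O(x log x)
    gives the main term, the tail of Li_2 being O(1/n).  The constant comes from
    sum 1/k^2 = pi^2/6, proved by comparing 1/x^2 with 1/sin(x)^2 at the points
    k pi/2^(n+1), where the sum of 1/sin^2 satisfies a linear recursion. *)

(** * Divisor sums and the Moebius function *)

Lemma big_nat_dvd_divisors (V : Type) (idx : V) (op : Monoid.com_law idx)
    (n m : nat) (P : pred nat) (F : nat -> V) : (0 < m <= n)%N ->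
  \big[op/idx]_(1 <= d < n.+1 | (d %| m)%N && P d) F d
  = \big[op/idx]_(d <- divisors m | P d) F d.
Proof.
move=> /andP[m_gt0 le_mn]; rewrite -big_filter -[RHS]big_filter.
have -> a : [seq i <- a | (i %| m)%N && P i]
  = [seq i <- [seq i <- a | (i %| m)%N] | P i].
  by rewrite -filter_predI; apply: eq_filter => i /=; rewrite andbC.
apply/perm_big/perm_filter.
apply: uniq_perm; rewrite ?divisors_uniq ?filter_uniq ?iota_uniq // => d.
rewrite mem_filter mem_index_iota -dvdn_divisors //.
case: (boolP (d %| m)%N) => //= dm.
by rewrite (dvdn_gt0 m_gt0 dm) ltnS (leq_trans (dvdn_leq m_gt0 dm)).
Qed.

Lemma big_nat_dvd (V : nmodType) (n d : nat) (F : nat -> V) : (0 < d)%N ->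
  \sum_(1 <= m < n.+1 | (d %| m)%N) F m = \sum_(1 <= j < (n %/ d).+1) F (d * j)%N.
Proof.
move=> d_gt0; rewrite -big_filter -(big_map (muln d) predT F).
apply: perm_big; apply: uniq_perm.
- by rewrite filter_uniq // iota_uniq.
- rewrite map_inj_uniq ?iota_uniq // => a b /eqP.
  by rewrite eqn_pmul2l // => /eqP.
move=> m; rewrite mem_filter mem_index_iota ltnS; apply/andP/mapP.
  case=> /dvdnP[j ->]; rewrite muln_gt0 => /andP[/andP[j_gt0 _] le].
  by exists j; rewrite 1?mulnC // mem_index_iota j_gt0 ltnS leq_divRL.
case=> j; rewrite mem_index_iota ltnS leq_divRL // => /andP[j_gt0 le] ->.
by rewrite dvdn_mulr // muln_gt0 d_gt0 j_gt0 mulnC.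
Qed.

(** Both sides run over the pairs with [d * j <= n], the right one grouped by the product [m]. *)
Lemma sum_multiples_divisors (V : nmodType) (n : nat) (G : nat -> nat -> V) :
  \sum_(1 <= d < n.+1) \sum_(1 <= j < (n %/ d).+1) G d (d * j)%N
  = \sum_(1 <= m < n.+1) \sum_(d <- divisors m) G d m.
Proof.
rewrite big_nat (eq_bigr (fun d => \sum_(1 <= m < n.+1 | (d %| m)%N) G d m)).
  rewrite -big_nat.
  rewrite (exchange_big_dep_nat predT) //= big_nat [RHS]big_nat.
  apply: eq_bigr => m ?.
  rewrite -(@big_nat_dvd_divisors _ _ _ n) //.
  by apply: eq_bigl => d; rewrite andbT.
by move=> d /andP[d_gt0 _]; rewrite big_nat_dvd.
Qed.

Lemma sum_hyperbola_swap (V : nmodType) (n : nat) (H : nat -> nat -> V) :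
  \sum_(1 <= d < n.+1) \sum_(1 <= j < (n %/ d).+1) H d j
  = \sum_(1 <= j < n.+1) \sum_(1 <= d < (n %/ j).+1) H d j.
Proof.
have widen (K : nat -> nat -> V) :
    \sum_(1 <= d < n.+1) \sum_(1 <= j < (n %/ d).+1) K d j
    = \sum_(1 <= d < n.+1) \sum_(1 <= j < n.+1 | (d * j <= n)%N) K d j.
  rewrite big_nat [RHS]big_nat; apply: eq_bigr => d /andP[d_gt0 _].
  rewrite (@big_nat_widen _ _ _ 1 (n %/ d).+1 n.+1) ?ltnS ?leq_div //.
  by apply: eq_bigl => j /=; rewrite ltnS leq_divRL // mulnC.
rewrite widen (widen (fun j d => H d j)).
rewrite (exchange_big_dep_nat predT) //=; apply: eq_bigr => j _.
by apply: eq_bigl => d; rewrite mulnC.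
Qed.

(** Squarefreeness is read off the valuations at the prime divisors. Since [primes 0] is empty, the
    value at 0 is the default 1; the sums below start at 1. *)
Definition mobius (n : nat) : int :=
  if all (fun p => logn p n == 1%N) (primes n) then (-1) ^+ size (primes n)
  else 0.

Lemma norm_mobius_le1 n : `|mobius n| <= 1.
Proof.
by rewrite /mobius; case: ifP => _; rewrite ?normr0 // normrX normrN1 expr1n.
Qed.

Lemma mobius_prime_mul p e : prime p -> (0 < e)%N -> ~~ (p %| e)%N ->
  mobius (p * e) = - mobius e.
Proof.
move=> p_pr e_gt0 pNe.
have p_gt0 := prime_gt0 p_pr.
have perm : perm_eq (primes (p * e)) (p :: primes e).
  apply: uniq_perm => [||q]; first exact: primes_uniq.
    by rewrite /= primes_uniq mem_primes (negPf pNe) !andbF.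
  by rewrite primesM // primes_prime // !inE.
rewrite /mobius (perm_all _ perm) (perm_size perm) /= lognM // logn_prime // eqxx.
rewrite logn_coprime ?prime_coprime //=.
rewrite (@eq_in_all _ _ (fun q => logn q e == 1%N)); last first.
  move=> q; rewrite mem_primes => /and3P[q_pr _ qe].
  rewrite lognM // logn_prime //; case: (eqVneq q p) => [qp|//].
  by rewrite -qp qe in pNe.
by case: ifP => _; rewrite ?oppr0 // exprS mulN1r.
Qed.

Lemma mobius_prime_sqr p e : prime p -> (0 < e)%N -> (p %| e)%N ->
  mobius (p * e) = 0.
Proof.
move=> p_pr e_gt0 pe; rewrite /mobius; case: ifP => // /allP /(_ p).
rewrite mem_primes p_pr muln_gt0 prime_gt0 // e_gt0 dvdn_mulr // => /(_ isT).
rewrite lognM ?(prime_gt0 p_pr) // (logn_prime p p_pr) eqxx.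
by case: (logn p e) (logn_gt0 p e) => //; rewrite mem_primes p_pr e_gt0 pe.
Qed.

Lemma sum_mobius_divisors n : (0 < n)%N ->
  \sum_(d <- divisors n) mobius d = (n == 1%N)%:R.
Proof.
move=> n_gt0; have [->|n_neq1] := eqVneq n 1%N; first by rewrite big_seq1.
have p_pr : prime (pdiv n) by rewrite pdiv_prime // ltn_neqAle eq_sym n_neq1.
have p_dvd := pdiv_dvd n; set p := pdiv n in p_pr p_dvd.
have p_gt0 := prime_gt0 p_pr.
(* Divisors d with p^2 | d contribute nothing; the others cancel in pairs
   (e, p e) with e prime to p. *)
rewrite (bigID (dvdn p)) /= (bigID (fun d => p %| d %/ p)%N) /=.
rewrite big_seq_cond big1 ?add0r => [|d]; last first.
  rewrite -dvdn_divisors // => /andP[dn /andP[/dvdnP[e de]]].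
  rewrite de mulnK // mulnC; apply: mobius_prime_sqr => //.
  by move: (dvdn_gt0 n_gt0 dn); rewrite de muln_gt0 => /andP[].
have perm : perm_eq
    [seq d <- divisors n | (p %| d)%N && ~~ (p %| d %/ p)%N]
    [seq (p * e)%N | e <- [seq e <- divisors n | ~~ (p %| e)%N]].
  apply: uniq_perm; rewrite ?filter_uniq ?divisors_uniq //.
    rewrite map_inj_uniq ?filter_uniq ?divisors_uniq // => a b /eqP.
    by rewrite eqn_pmul2l // => /eqP.
  move=> d; rewrite mem_filter -dvdn_divisors //; apply/idP/mapP.
    move=> /andP[/andP[/dvdnP[e ->]]]; rewrite mulnK // => pNe en.
    exists e; last by rewrite mulnC.
    by rewrite mem_filter pNe -dvdn_divisors // (dvdn_trans _ en) // dvdn_mulr.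
  case=> e; rewrite mem_filter -dvdn_divisors // => /andP[pNe en] ->.
  by rewrite dvdn_mulr // mulKn // pNe Gauss_dvd ?prime_coprime // p_dvd.
rewrite -big_filter (perm_big _ perm) big_map big_filter -big_split /=.
rewrite big_seq_cond big1 // => e; rewrite -dvdn_divisors // => /andP[en pNe].
by rewrite mobius_prime_mul ?addNr // (dvdn_gt0 n_gt0).
Qed.

(** Grouping by [m = d * j], the term [F m] gets as coefficient the sum of [mobius] over the
    divisors of [m], which vanishes unless [m] is 1. It serves twice: for the totient sums and for
    the truncated series of inverse squares. *)
Lemma mobius_inversion (V : zmodType) (n : nat) (F : nat -> V) : (0 < n)%N ->
  \sum_(1 <= d < n.+1) (\sum_(1 <= j < (n %/ d).+1) F (d * j)%N) *~ mobius d
  = F 1%N.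
Proof.
move=> n_gt0.
under eq_bigr do rewrite mulrz_suml.
rewrite (sum_multiples_divisors n (fun d m => F m *~ mobius d)).
rewrite big_nat (eq_bigr (fun m => F m *+ (m == 1%N))); last first.
  move=> m /andP[m_gt0 _]; rewrite -mulrz_sumr sum_mobius_divisors //.
  by case: eqP.
rewrite -big_nat big_ltn // big_nat big1 ?addr0 // => m /andP[m_gt1 _].
by rewrite gtn_eqF.
Qed.

Lemma sum_sum_totient n :
  (\sum_(1 <= j < n.+1) \sum_(1 <= d < (n %/ j).+1) totient d
   = \sum_(1 <= m < n.+1) m)%N.
Proof.
have := sum_multiples_divisors n (fun d _ => totient d).
rewrite (sum_hyperbola_swap n (fun d _ => totient d)) => ->.
apply: eq_big_nat => m /andP[m_gt0 _].
rewrite -(@big_nat_dvd_divisors _ _ _ m) ?m_gt0 ?leqnn //.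
apply: etrans (sum_totient_dvd m).
rewrite -(big_mkord (fun d => d %| m)%N totient) [RHS]big_ltn_cond //.
rewrite dvd0n gtn_eqF //; apply: eq_bigl => d; rewrite andbT //.
Qed.

(** Inversion applied to the totient sums up to [n %/ m]; nested floors collapse by [divnMA], and
    [sum_sum_totient] evaluates the inner sums. *)
Lemma totient_sumE n : (0 < n)%N ->
  (\sum_(1 <= d < n.+1) totient d)%:Z
  = \sum_(1 <= d < n.+1) (\sum_(1 <= m < (n %/ d).+1) m)%:Z * mobius d.
Proof.
move=> n_gt0.
have := mobius_inversion (fun m => (\sum_(1 <= d < (n %/ m).+1) totient d)%:Z) n_gt0.
rewrite divn1 => <-; apply: eq_bigr => d _.
rewrite -sum_sum_totient -mulrzl mulrC intz; congr (_ * _).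
rewrite (big_morph Posz PoszD (erefl _)).
by apply: eq_bigr => j _; rewrite divnMA.
Qed.

(** * Least common multiples of q-integers *)

(** The gcd is [g] only up to a nonzero constant, which the division by the leading coefficient in
    [lcmpoly] removes. *)
Lemma lcmpoly_mul_coprime (g a b : {poly rat}) :
    g \is monic -> a \is monic -> b \is monic -> coprimep a b ->
  lcmpoly (g * a) (g * b) = g * a * b.
Proof.
move=> g_mon a_mon b_mon ab.
have gcd_g : gcdp (g * a) (g * b) %= g.
  rewrite (eqp_trans (gcdp_mul2l _ _ _)) // -[X in _ %= X]mulr1.
  by rewrite eqp_mull // -size_poly_eq1.
have /eqpf_eq[c c_neq0 gcdE] := gcd_g.
rewrite /lcmpoly gcdE divpZr // mulrA mulrAC mulpK ?monic_neq0 //.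
have /monicP mon : g * a * b \is monic by rewrite !monicMl.
by rewrite lead_coefZ mon mulr1 invrK scalerA mulfV // scale1r.
Qed.

Definition cyclotomic_rat (d : nat) : {poly rat} := map_poly intr 'Phi_d.

Lemma cyclotomic_rat_monic d : cyclotomic_rat d \is monic.
Proof. exact/monic_map/Cyclotomic_monic. Qed.

Lemma size_cyclotomic_rat d : size (cyclotomic_rat d) = (totient d).+1.
Proof. by rewrite size_map_inj_poly ?size_Cyclotomic //; exact: intr_inj. Qed.

Lemma prod_cyclotomic_rat n : (0 < n)%N ->
  \prod_(d <- divisors n) cyclotomic_rat d = 'X^n - 1.
Proof.
move=> n_gt0; rewrite -rmorph_prod /= prod_Cyclotomic //.
by rewrite rmorphB rmorph1 /= map_polyXn.
Qed.

(* Their product divides the separable polynomial X^(de) - 1. *)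
Lemma coprimep_cyclotomic_rat d e : d != e ->
  coprimep (cyclotomic_rat d) (cyclotomic_rat e).
Proof.
have [->|d_gt0] := posnP d.
  by rewrite /cyclotomic_rat Cyclotomic0 rmorph1 coprime1p.
have [->|e_gt0] := posnP e.
  by rewrite /cyclotomic_rat Cyclotomic0 rmorph1 coprimep1.
move=> de; have de_gt0 : (0 < d * e)%N by rewrite muln_gt0 d_gt0.
apply: (@separable_coprime _ ('X^(d * e) - 1)).
  by apply: separable_Xn_sub_1; rewrite pnatr_eq0 -lt0n.
rewrite -prod_cyclotomic_rat // (bigD1_seq d) ?divisors_uniq //=; last first.
  by rewrite -dvdn_divisors // dvdn_mulr.
rewrite -big_filter (bigD1_seq e) ?filter_uniq ?divisors_uniq //=; last first.
  by rewrite mem_filter eq_sym de -dvdn_divisors // dvdn_mull.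
by rewrite mulrA dvdp_mulr.
Qed.

Section CyclotomicProducts.

Variable n : nat.
Implicit Types D E : {set 'I_n}.

(** Encoding such products by their index sets turns least common multiples into unions. *)
Definition prod_cyclo D : {poly rat} := \prod_(d in D) cyclotomic_rat d.

Lemma prod_cyclo_monic D : prod_cyclo D \is monic.
Proof. by apply: monic_prod => d _; exact: cyclotomic_rat_monic. Qed.

Lemma size_prod_cyclo D : (size (prod_cyclo D)).-1 = (\sum_(d in D) totient d)%N.
Proof.
(* Monicity is carried through the induction because it makes degrees add. *)
suff [] : prod_cyclo D \is monic /\ (size (prod_cyclo D)).-1
    = (\sum_(d in D) totient d)%N by [].
apply: (big_ind2 (fun p s => p \is monic /\ (size p).-1 = s)).
- by rewrite monic1 size_poly1.
- move=> p s q t [p_mon <-] [q_mon <-]; rewrite monicMl // size_proper_mul.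
    split=> //; have := monic_neq0 p_mon; have := monic_neq0 q_mon.
    rewrite -!size_poly_gt0; case: (size p) => // a; case: (size q) => // b _ _.
    by rewrite addnS.
  by rewrite (monicP p_mon) (monicP q_mon) mulr1 oner_neq0.
- by move=> d _; rewrite cyclotomic_rat_monic size_cyclotomic_rat.
Qed.

(** The indices in [D :&: E] give the common factor; the factors from the two set differences are
    coprime, so [lcmpoly_mul_coprime] applies. *)
Lemma lcm_prod_cyclo D E :
  lcmpoly (prod_cyclo D) (prod_cyclo E) = prod_cyclo (D :|: E).
Proof.
have prodID X Y : prod_cyclo X = prod_cyclo (X :&: Y) * prod_cyclo (X :\: Y).
  exact: big_setID.
rewrite (prodID D E) (prodID E D) [E :&: D]finset.setIC.
rewrite lcmpoly_mul_coprime ?prod_cyclo_monic //; last first.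
  rewrite /prod_cyclo.
  apply: (big_ind (fun p => coprimep p _)) => [|p q cp cq|d].
  - exact: coprime1p.
  - by rewrite coprimepMl cp.
  rewrite inE => /andP[dNE _].
  apply: (big_ind (fun q => coprimep _ q)) => [|p q cp cq|e].
  - exact: coprimep1.
  - by rewrite coprimepMr cp.
  rewrite inE => /andP[_ eE]; apply: coprimep_cyclotomic_rat.
  by apply: contraNneq dNE => /val_inj ->.
rewrite [RHS](prodID _ D) finset.setUK finset.setDUl finset.setDv.
by rewrite finset.set0U -prodID.
Qed.

End CyclotomicProducts.

(** After multiplication by ['X - 1], which is the cyclotomic polynomial of index 1, both sides
    become ['X^k - 1]. The bound [k < n] lets every divisor of [k] be an index in ['I_n]. *)
Lemma qint_prod_cyclo n k : (0 < k < n)%N ->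
  qint k = prod_cyclo [set d : 'I_n | (1 < d)%N && (d %| k)%N].
Proof.
case: n => [/andP[_ /[!ltn0]]//|n /andP[k_gt0 le_kn]].
have X1 : 'X - 1 = cyclotomic_rat 1.
  by rewrite -(@prod_cyclotomic_rat 1) // big_seq1.
apply: (@mulfI _ ('X - 1)); first by rewrite X1 monic_neq0 ?cyclotomic_rat_monic.
rewrite /qint -subrX1 -prod_cyclotomic_rat //.
rewrite (bigD1_seq 1%N) ?divisors_uniq ?divisor1 //= X1; congr (_ * _).
rewrite -(@big_nat_dvd_divisors _ _ _ n) ?k_gt0 //.
rewrite /prod_cyclo (eq_bigl _ _ (fun d => finset.in_set _ d)) /=.
rewrite -(big_mkord (fun d => (1 < d)%N && (d %| k)%N)) [RHS]big_ltn_cond //.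
rewrite [LHS]big_nat_cond [RHS]big_nat_cond; apply: eq_bigl => d.
by case: d => [|[|d]] //=; rewrite ?andbF ?andbT.
Qed.

(** Divisors are indexed without shift, hence by ['I_n.+1], while [i : 'I_n] stands for [i.+1]. *)
Lemma lcm_seq_qint n (A : {set 'I_n}) (s : seq 'I_n) :
  lcm_seq [seq qint (val i).+1 | i <- s]
  = prod_cyclo [set d : 'I_n.+1 | (1 < d)%N && has (fun i : 'I_n => d %| i.+1)%N s].
Proof.
elim: s => [|i s IH] /=.
  by rewrite /prod_cyclo big1 // => d; rewrite inE andbF.
rewrite IH (@qint_prod_cyclo n.+1) ?ltnS ?ltn_ord // lcm_prod_cyclo.
by congr prod_cyclo; apply/finset.setP => d; rewrite !inE -andb_orr.
Qed.

Lemma deg_lcm_qE n (A : {set 'I_n}) :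
  deg_lcm_q A =
  (\sum_(2 <= d < n.+1 | [exists i : 'I_n, (i \in A) && (d %| i.+1)%N])
     totient d)%N.
Proof.
rewrite /deg_lcm_q lcm_seq_qint // size_prod_cyclo.
rewrite (eq_bigl _ _ (fun d => finset.in_set _ d)) /=.
rewrite -(big_mkord (fun d => (1 < d)%N && has (fun i : 'I_n => d %| i.+1)%N (enum A))).
rewrite (@big_nat_widenl _ _ _ 2 0) // [LHS]big_nat_cond [RHS]big_nat_cond.
apply: eq_bigl => d; rewrite [(1 < d)%N && _]andbC; congr [&& _, _ & _].
apply/hasP/existsP => [[i]|[i /andP[iA di]]].
  by rewrite mem_enum => iA di; exists i; rewrite iA.
by exists i; rewrite ?mem_enum.
Qed.

(** * The expected degree *)

Section Expectation.
Variables (R : realType) (n : nat) (alpha : R).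

(** This is the probability that the random set misses [M]. It comes from expanding a product over
    the points [i] by distributivity, the summand [alpha] being suppressed when [i] lies in [M]. *)
Lemma sum_weights_disjoint (M : {set 'I_n}) :
  \sum_(A : {set 'I_n})
    alpha ^+ #|A| * (1 - alpha) ^+ (n - #|A|) * [disjoint A & M]%:R
  = (1 - alpha) ^+ #|M|.
Proof.
transitivity (\prod_(i < n) (alpha * (i \notin M)%:R + (1 - alpha))); last first.
  rewrite (bigID [in M]) /= -[RHS]mulr1; congr (_ * _).
    rewrite -prodr_const; apply: eq_bigr => i iM.
    by rewrite iM mulr0 add0r.
  by rewrite big1 // => i ->; rewrite mulr1 addrC subrK.
rewrite bigA_distr; apply: eq_bigr => A _.
rewrite [RHS](bigID [in A]) /= mulrAC; congr (_ * _).
  rewrite (eq_bigr (fun i => alpha * (i \notin M)%:R)) => [|i ->//].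
  rewrite big_split prodr_const /=; congr (_ * _).
  have [dAM|/pred0Pn[i /andP[/= iA iM]]] := boolP [disjoint A & M].
    by rewrite big1 // => i iA; rewrite (disjointFr dAM iA).
  by rewrite (bigD1 i) //= iM mul0r.
rewrite (eq_bigr (fun=> 1 - alpha)) => [|i /negPf ->//].
rewrite prodr_const; congr (_ ^+ _).
by rewrite -{1}(card_ord n) -(cardC A) addKn.
Qed.

Lemma card_multiples d : (0 < d)%N ->
  #|[set i : 'I_n | (d %| i.+1)%N]| = (n %/ d)%N.
Proof.
move=> d_gt0; rewrite cardsE -sum1_card.
rewrite -(big_mkord (fun i => d %| i.+1)%N (fun=> 1%N)).
transitivity (\sum_(1 <= m < n.+1 | (d %| m)%N) 1)%N; first by rewrite big_add1.
rewrite big_nat_dvd //.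
by rewrite sum_nat_const_nat muln1 subSS subn0.
Qed.

(** Linearity of expectation: [totient d] is counted unless [A] misses all [n %/ d] multiples of
    [d]. *)
Lemma expected_deg_lcmE :
  expected_deg_lcm n alpha
  = \sum_(2 <= d < n.+1) (totient d)%:R * (1 - (1 - alpha) ^+ (n %/ d)).
Proof.
rewrite /expected_deg_lcm.
transitivity (\sum_(A : {set 'I_n}) \sum_(2 <= d < n.+1) (totient d)%:R *
  (alpha ^+ #|A| * (1 - alpha) ^+ (n - #|A|) *
     (1 - [disjoint A & [set i : 'I_n | (d %| i.+1)%N]]%:R))).
  apply: eq_bigr => A _; rewrite deg_lcm_qE natr_sum mulr_sumr big_mkcond /=.
  apply: eq_bigr => d _; rewrite mulrC.
  set b := [exists i, _]; have -> : [disjoint A & [set i : 'I_n | (d %| i.+1)%N]] = ~~ b.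
    rewrite negb_exists; apply/pred0P/forallP => h i.
      by have := h i; rewrite /= inE => ->.
    by rewrite /= inE; apply/negbTE/h.
  by case: b; rewrite ?subr0 ?subrr ?mulr1 ?mulr0 ?mul0r // mulrC.
rewrite exchange_big; apply: eq_big_nat => d /andP[d_gt1 _].
rewrite -mulr_sumr; congr (_ * _).
under eq_bigr do rewrite mulrBr.
rewrite sumrB sum_weights_disjoint card_multiples 1?ltnW //; congr (_ - _).
(* The total weight is 1: this is [sum_weights_disjoint] for the empty set. *)
rewrite -[RHS](expr0 (1 - alpha)) -(cards0 'I_n) -sum_weights_disjoint.
by apply: eq_bigr => A _; rewrite -finset.setI_eq0 finset.setI0 eqxx mulr1.
Qed.

End Expectation.

(** * The sum of the inverse squares *)

Section Basel.
Variable R : realType.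
Implicit Types x : R.

Lemma sin_le x : 0 <= x -> sin x <= x.
Proof.
move=> x_ge0.
have der y : y \in `]0, x[ -> is_derive y 1 sin (cos y) by move=> _; exact: is_derive_sin.
have [|c _] := MVT_segment x_ge0 der.
  by apply: derivable_within_continuous => y _; exact: derivable_sin.
rewrite sin0 !subr0 => ->.
by rewrite ler_piMl // cos_le1.
Qed.

Lemma le_tan x : 0 <= x < pi / 2 -> x <= tan x.
Proof.
move=> /andP[x_ge0 x_lt].
have cos_gt0 y : 0 <= y <= x -> 0 < cos y.
  move=> /andP[y_ge0 yx]; apply: cos_gt0_pihalf.
  rewrite (le_lt_trans yx x_lt) andbT (lt_le_trans _ y_ge0) //.
  by rewrite oppr_lt0 divr_gt0 // pi_gt0.
have der y : y \in `]0, x[ -> is_derive y 1 tan ((cos y) ^- 2).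
  rewrite in_itv /= => /andP[/ltW y0 /ltW yx].
  by apply: is_derive_tan; rewrite gt_eqF // cos_gt0 // y0.
have [|c] := MVT_segment x_ge0 der.
  apply: derivable_within_continuous => y; rewrite in_itv /= => y0x.
  by apply: derivable_tan; rewrite gt_eqF // cos_gt0.
rewrite in_itv /= => c0x; rewrite tan0 !subr0 => ->.
by rewrite ler_peMl // invf_ge1 ?exprn_gt0 ?cos_gt0 //.
Qed.

(** From [sin x <= x <= tan x], since the inverse squares of [sin x] and [tan x] differ by exactly
    1. *)
Lemma inv_sin_sqr_bounds x : 0 < x < pi / 2 ->
  (x ^+ 2)^-1 <= (sin x ^+ 2)^-1 <= (x ^+ 2)^-1 + 1.
Proof.
move=> /andP[x_gt0 x_lt].
have sin_gt0 : 0 < sin x by rewrite sin_gt0_pihalf // x_gt0.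
have cos_gt0 : 0 < cos x.
  by rewrite cos_gt0_pihalf // x_lt andbT (lt_trans _ x_gt0) // oppr_lt0 divr_gt0 // pi_gt0.
apply/andP; split.
  rewrite lef_pV2 ?posrE ?exprn_gt0 // ler_pXn2r ?nnegrE ?(ltW sin_gt0) ?(ltW x_gt0) //.
  by rewrite sin_le // ltW.
have -> : (sin x ^+ 2)^-1 = (tan x ^+ 2)^-1 + 1.
  rewrite /tan; transitivity ((cos x ^+ 2 + sin x ^+ 2) / sin x ^+ 2).
    by rewrite cos2Dsin2 mul1r.
  by field; rewrite !gt_eqF.
rewrite lerD2r lef_pV2 ?posrE ?exprn_gt0 ?divr_gt0 //.
have tan_gt0 : 0 < tan x by rewrite divr_gt0.
by rewrite ler_pXn2r ?nnegrE ?(ltW tan_gt0) ?(ltW x_gt0) // le_tan // ltW.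
Qed.

Definition inv_sin_sqr_sum n : R :=
  \sum_(1 <= k < 2 ^ n) (sin (k%:R * (pi / 2 ^+ n.+1)) ^+ 2)^-1.

(* Reflect the upper half of the points about pi/4 and use
   1/sin(x)^2 + 1/cos(x)^2 = 4/sin(2x)^2; the middle point contributes 2. *)
Lemma inv_sin_sqr_sumS n : inv_sin_sqr_sum n.+1 = 2 + 4 * inv_sin_sqr_sum n.
Proof.
have e2_gt0 : (0 < 2 ^ n)%N by rewrite expn_gt0.
have e2_neq0 m : 2 ^+ m != 0 :> R by rewrite expf_neq0.
rewrite /inv_sin_sqr_sum; set t := pi / 2 ^+ n.+2.
have t2 : pi / 2 ^+ n.+1 = t *+ 2.
  by rewrite /t [in RHS]exprS; field; rewrite e2_neq0.
have midt : (2 ^ n)%:R * t = pi / 4.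
  by rewrite /t natrX !exprS; field; rewrite e2_neq0.
have le1 : (2 ^ n <= 2 ^ n.+1)%N by rewrite leq_exp2l.
rewrite (@big_cat_nat _ _ _ (2 ^ n)) //= [X in _ + X]big_ltn ?ltn_exp2l //.
rewrite midt.
have -> : (sin (pi / 4 : R) ^+ 2)^-1 = 2.
  have cos_gt0 : 0 < cos (pi / 4 : R).
    apply: cos_gt0_pihalf; rewrite (@lt_trans _ _ 0) ?oppr_lt0 ?divr_gt0 ?pi_gt0 //=.
    by rewrite ltr_pM2l ?pi_gt0 // ltf_pV2 ?posrE // ltr_nat.
  have := cos2Dsin2 (pi / 4 : R).
  have : sin (pi / 4 : R) = cos (pi / 4 : R).
    by apply: divr1_eq; rewrite -/(tan _) tan_piquarter.
  move=> -> h; have -> : cos (pi / 4 : R) ^+ 2 = 2^-1 by lra.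
  exact: invrK.
rewrite addrCA; congr (_ + _).
have -> : \sum_((2 ^ n).+1 <= k < 2 ^ n.+1) (sin (k%:R * t) ^+ 2)^-1
    = \sum_(1 <= k < 2 ^ n) (cos (k%:R * t) ^+ 2)^-1.
  rewrite big_nat_rev /= -{1}[(2 ^ n).+1]add1n big_addn.
  have -> : (2 ^ n.+1 - 2 ^ n = 2 ^ n)%N by rewrite expnS mul2n -addnn addnK.
  apply: eq_big_nat => k /andP[k_gt0 k_lt].
  have -> : ((2 ^ n).+1 + 2 ^ n.+1 - (k + 2 ^ n).+1 = 2 ^ n.+1 - k)%N.
    by rewrite addSn subSS [(k + _)%N]addnC subnDl.
  rewrite natrB; last by rewrite (leq_trans (ltnW k_lt)).
  rewrite mulrBl expnS natrM -mulrA midt -cosN -sinDpihalf.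
  by congr ((sin _ ^+ 2)^-1); field.
rewrite -big_split mulr_sumr /=.
apply: eq_big_nat => k /andP[k_gt0 k_lt].
rewrite t2 mulrnAr sin_mulr2n.
set x := k%:R * t.
have x_gt0 : 0 < x by rewrite mulr_gt0 ?ltr0n // divr_gt0 ?pi_gt0 ?exprn_gt0.
have x_lt : x < pi / 2.
  rewrite (@lt_trans _ _ (pi / 4)) //; last by rewrite ltr_pM2l ?pi_gt0 // ltf_pV2 ?posrE // ltr_nat.
  by rewrite -midt ltr_pM2r ?ltr_nat // divr_gt0 ?pi_gt0 ?exprn_gt0.
have s0 : sin x != 0 by rewrite gt_eqF // sin_gt0_pihalf // x_gt0.
have c0 : cos x != 0.
  by rewrite gt_eqF // cos_gt0_pihalf // x_lt andbT (lt_trans _ x_gt0) // oppr_lt0 divr_gt0 // pi_gt0.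
have := cos2Dsin2 x.
move: (sin x) (cos x) s0 c0 => s c s0 c0 sc.
transitivity ((c ^+ 2 + s ^+ 2) / (s ^+ 2 * c ^+ 2)).
  by field; rewrite s0 c0.
by rewrite sc; field; rewrite s0.
Qed.

Lemma inv_sin_sqr_sumE n : inv_sin_sqr_sum n = 2 * (4 ^+ n - 1) / 3.
Proof.
elim: n => [|n IH]; first by rewrite /inv_sin_sqr_sum big_geq // expr0 subrr; field.
by rewrite inv_sin_sqr_sumS IH exprS; field.
Qed.


(** Sum [inv_sin_sqr_bounds] over the dyadic points and rescale by the square of the step [t]. The
    additive 1 occurs fewer than [2 ^ n] times against a scale of order [4 ^ n], so the error is of
    order [2 ^- n]. *)
Lemma sum_inv_sqr_dyadic n :
  pi ^+ 2 / 6 - pi ^+ 2 / 2 ^+ n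
  <= \sum_(1 <= k < 2 ^ n) ((k%:R : R) ^+ 2)^-1 <= pi ^+ 2 / 6.
Proof.
set S := \sum_(1 <= k < 2 ^ n) _.
pose t : R := pi / 2 ^+ n.+1.
have pi_gt0 := pi_gt0 R.
have t_gt0 : 0 < t by rewrite divr_gt0 // exprn_gt0.
have bounds k : (1 <= k < 2 ^ n)%N ->
    ((k%:R * t) ^+ 2)^-1 <= (sin (k%:R * t) ^+ 2)^-1 <= ((k%:R * t) ^+ 2)^-1 + 1.
  move=> /andP[k_gt0 k_lt]; apply: inv_sin_sqr_bounds.
  rewrite mulr_gt0 ?ltr0n //=.
  have -> : k%:R * t = k%:R / 2 ^+ n * (pi / 2).
    by rewrite /t exprS; field; rewrite expf_neq0.
  rewrite gtr_pMl ?divr_gt0 // ltr_pdivrMr ?exprn_gt0 // mul1r -natrX.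
  by rewrite ltr_nat.
have SE : \sum_(1 <= k < 2 ^ n) ((k%:R * t) ^+ 2)^-1 = S * (4 * 4 ^+ n / pi ^+ 2).
  rewrite mulr_suml; apply: eq_big_nat => k /andP[k_gt0 _].
  rewrite /t exprMn expr_div_n invfM invf_div; congr (_ * (_ / _)).
  by rewrite exprAC exprS; congr (_ * _ ^+ _); ring.
have le1 : S * (4 * 4 ^+ n / pi ^+ 2) <= inv_sin_sqr_sum n.
  by rewrite -SE; apply: ler_sum_nat => k /bounds /andP[].
have le2 : inv_sin_sqr_sum n <= S * (4 * 4 ^+ n / pi ^+ 2) + 2 ^+ n.
  rewrite -SE.
  apply: (@le_trans _ _ (\sum_(1 <= k < 2 ^ n) (((k%:R * t) ^+ 2)^-1 + 1))).
    by apply: ler_sum_nat => k /bounds /andP[].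
  rewrite big_split lerD2l /= sumr_const_nat natrB ?expn_gt0 // natrX.
  by rewrite gerBl ler01.
move: le1 le2; rewrite inv_sin_sqr_sumE.
have -> : 4 ^+ n = (2 ^+ n) ^+ 2 :> R.
  by rewrite exprAC; congr (_ ^+ _); ring.
have : 1 <= 2 ^+ n :> R by rewrite exprn_ege1 // ler1n.
move: (2 ^+ n : R) => y y_ge1 le1 le2.
have p2_gt0 : 0 < pi ^+ 2 :> R by rewrite exprn_gt0.
move: (pi ^+ 2 : R) p2_gt0 le1 le2 => p p_gt0.
have y_gt0 : 0 < y by lra.
(* In terms of [S / p] the bounds become linear in [y ^+ 2 * s]. *)
have {3 4}-> : S = (S / p) * p by rewrite divfK // gt_eqF.
have assoc : S * (4 * y ^+ 2 / p) = 4 * y ^+ 2 * (S / p) by ring.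
rewrite !assoc; move: (S / p) => s le1 le2.
have y2_gt0 : 0 < 4 * y ^+ 2 by rewrite mulr_gt0 ?exprn_gt0.
have -> : p / 6 - p / y = (6^-1 - y^-1) * p by ring.
rewrite [p / 6]mulrC !ler_pM2r //; apply/andP; split; rewrite -(ler_pM2l y2_gt0); last by lra.
have -> : 4 * y ^+ 2 * (6^-1 - y^-1) = 4 * y ^+ 2 / 6 - 4 * y.
  by field; rewrite gt_eqF.
lra.
Qed.

(** Telescoping, because the inverse square of [y + 1] is at most the inverse of [y * (y + 1)]. *)
Lemma sum_inv_sqr_nat N M : (0 < N)%N ->
  \sum_(N.+1 <= k < N.+1 + M) ((k%:R : R) ^+ 2)^-1 <= N%:R^-1 - (N + M)%:R^-1.
Proof.
move=> N_gt0; elim: M => [|M IH]; first by rewrite big_geq ?addn0 ?subrr.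
rewrite addnS big_nat_recr ?leq_addr //= addnS addSn.
have NM_gt0 : 0 < (N + M)%:R :> R by rewrite ltr0n addn_gt0 N_gt0.
apply: (le_trans (lerD IH (lexx _))).
rewrite -[((N + M).+1)%:R]natr1; move: ((N + M)%:R : R) NM_gt0 => y y_gt0.
suff : ((y + 1) ^+ 2)^-1 <= y^-1 - (y + 1)^-1 by lra.
have -> : y^-1 - (y + 1)^-1 = (y * (y + 1))^-1 by field; rewrite ?gt_eqF //; lra.
by rewrite lef_pV2 ?posrE ?exprn_gt0 ?mulr_gt0 //; try lra.
Qed.

Lemma sum_inv_sqr_tail_le N M : (0 < N)%N ->
  \sum_(N.+1 <= k < M) ((k%:R : R) ^+ 2)^-1 <= N%:R^-1.
Proof.
move=> N_gt0; have [NM|MN] := leqP N.+1 M; last first.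
  by rewrite big_geq ?invr_ge0 // ltnW.
rewrite -(subnKC NM); apply: (le_trans (sum_inv_sqr_nat (M - N.+1) N_gt0)).
by rewrite gerBl invr_ge0.
Qed.

(** Compare with a longer dyadic sum: the terms beyond [N] are nonnegative and add up to at most
    [N%:R^-1]. *)
Lemma sum_inv_sqr_bounds N : (0 < N)%N ->
  pi ^+ 2 / 6 - N%:R^-1 <= \sum_(1 <= k < N.+1) ((k%:R : R) ^+ 2)^-1 <= pi ^+ 2 / 6.
Proof.
move=> N_gt0; have term_ge0 k : 0 <= (k%:R ^+ 2)^-1 :> R by rewrite invr_ge0 exprn_ge0.
have split_sum M : (N.+1 <= M)%N ->
    \sum_(1 <= k < M) ((k%:R : R) ^+ 2)^-1 = \sum_(1 <= k < N.+1) ((k%:R : R) ^+ 2)^-1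
    + \sum_(N.+1 <= k < M) ((k%:R : R) ^+ 2)^-1.
  by move=> NM; rewrite (@big_cat_nat _ _ _ N.+1).
apply/andP; split; last first.
  have /andP[_] := sum_inv_sqr_dyadic N.+1.
  apply: le_trans; rewrite (split_sum (2 ^ N.+1)%N) ?lerDl ?sumr_ge0 //.
  by rewrite ltnW // ltn_expl.
apply/ler_addgt0Pr => e e_gt0.
(* Large enough for [2 ^ n] to pass [N] and to push the dyadic error below [e]. *)
pose n := maxn N.+1 (Num.bound (pi ^+ 2 / e)).
have /andP[+ _] := sum_inv_sqr_dyadic n.
have Nn : (N.+1 <= 2 ^ n)%N by rewrite (leq_trans _ (ltnW (ltn_expl _ _))) // leq_maxl.
rewrite split_sum // => h.
have small : pi ^+ 2 / 2 ^+ n <= e.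
  rewrite ler_pdivrMr ?exprn_gt0 // mulrC -ler_pdivrMr //.
  apply/ltW/(lt_le_trans (archi_boundP _)); first by rewrite divr_ge0 ?exprn_ge0 ?pi_ge0 // ltW.
  by rewrite -natrX ler_nat (leq_trans _ (ltnW (ltn_expl _ _))) // leq_maxr.
have := @sum_inv_sqr_tail_le N (2 ^ n) N_gt0.
lra.
Qed.

End Basel.

(** * The summatory function of the totient *)

Section Asymptotics.
Variable R : realType.

Definition harmonic_sum (n : nat) : R := \sum_(1 <= k < n.+1) k%:R^-1.

Lemma harmonic_sum_le m n : (m <= n)%N -> harmonic_sum m <= harmonic_sum n.
Proof.
move=> mn; rewrite /harmonic_sum [leRHS](@big_cat_nat _ _ _ m.+1) //= lerDl.
by apply: sumr_ge0 => k _; rewrite invr_ge0.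
Qed.

Lemma harmonic_sum_ge1 n : (0 < n)%N -> 1 <= harmonic_sum n.
Proof. by move=> /harmonic_sum_le; apply: le_trans; rewrite /harmonic_sum big_nat1 invr1. Qed.

(** Each new term is at most the increment of [ln], by [ln (1 + x) <= x] at a negative [x]. *)
Lemma harmonic_sum_le_ln n : (0 < n)%N -> harmonic_sum n <= 1 + ln n%:R.
Proof.
case: n => // n _; elim: n => [|n IH].
  by rewrite /harmonic_sum big_nat1 ln1 invr1 addr0.
rewrite /harmonic_sum big_nat_recr //=; apply: (le_trans (lerD IH (lexx _))).
rewrite -addrA lerD2l.
have n1_gt0 : 0 < n.+1%:R :> R by rewrite ltr0n.
have n2_gt0 : 0 < n.+2%:R :> R by rewrite ltr0n.
have E : n.+1%:R / n.+2%:R = 1 + - n.+2%:R^-1 :> R.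
  rewrite -[n.+2%:R]natr1; move: (n.+1%:R : R) n1_gt0 => y y_gt0.
  by field; rewrite gt_eqF // ltr_wpDr.
have := @le_ln1Dx R (- n.+2%:R^-1).
rewrite -E ln_div ?posrE // ltrN2 invf_lt1 ?ltr1n // => /(_ isT).
by rewrite lerBlDl lerBrDr.
Qed.

Lemma natr_divn_bounds (m d : nat) : (0 < d <= m)%N ->
  [/\ 1 <= (m %/ d)%:R :> R, (m %/ d)%:R <= m%:R / d%:R :> R
    & m%:R / d%:R < (m %/ d)%:R + 1 :> R].
Proof.
move=> /andP[d_gt0 dm]; have dR_gt0 : 0 < d%:R :> R by rewrite ltr0n.
split; first by rewrite ler1n divn_gt0.
  by rewrite ler_pdivlMr // -natrM ler_nat leq_divM.
by rewrite natr1 ltr_pdivrMr // -natrM ltr_nat ltn_ceil.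
Qed.

Lemma sum_iota_natr k : (\sum_(1 <= m < k.+1) m)%:R = k%:R * (k%:R + 1) / 2 :> R.
Proof.
elim: k => [|k IH]; first by rewrite big_geq // !mul0r.
by rewrite big_nat_recr //= natrD IH -[k.+1%:R]natr1; field.
Qed.

Definition totient_sum (n : nat) : R := (\sum_(1 <= d < n.+1) totient d)%:R.

Lemma totient_sum_mobius n : (0 < n)%N -> totient_sum n
  = \sum_(1 <= d < n.+1) (n %/ d)%:R * ((n %/ d)%:R + 1) / 2 * (mobius d)%:~R.
Proof.
move=> /totient_sumE /(congr1 (intr : int -> R)).
rewrite -[LHS]/(totient_sum n) => ->.
rewrite rmorph_sum; apply: eq_bigr => d _.
by rewrite rmorphM /= -sum_iota_natr.
Qed.

Lemma norm_mobius_intr_le1 d : `|(mobius d)%:~R : R| <= 1.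
Proof. by rewrite -intr_norm (ler_int _ _ 1) norm_mobius_le1. Qed.

(** The limit of [S], so that [3 / pi ^+ 2] is the inverse of [2 * c]. *)
Let c : R := pi ^+ 2 / 6.
Let S n : R := \sum_(1 <= k < n.+1) (k%:R ^+ 2)^-1.

(* The truncated identity sum mu(d)/d^2 * sum_(j <= n/d) 1/j^2 = 1, with the
   inner sum replaced by its limit c. *)
Lemma mobius_sum_inv_sqr n : (0 < n)%N ->
  `|c * (\sum_(1 <= d < n.+1) (mobius d)%:~R / d%:R ^+ 2) - 1|
  <= 2 / n%:R * harmonic_sum n.
Proof.
move=> n_gt0.
have sumE : \sum_(1 <= d < n.+1) S (n %/ d) / d%:R ^+ 2 * (mobius d)%:~R = 1.
  rewrite -[RHS]invr1 -[in RHS](expr1n R 2).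
  rewrite -(mobius_inversion (fun m => (m%:R ^+ 2 : R)^-1) n_gt0).
  apply: eq_bigr => d _; rewrite mulrzr; congr (_ *~ _).
  rewrite /S mulr_suml; apply: eq_bigr => j _.
  by rewrite natrM exprMn [in RHS]invfM mulrC.
rewrite -[X in `|_ - X|]sumE.
rewrite mulr_sumr -sumrB mulr_sumr (le_trans (ler_norm_sum _ _ _)) //.
apply: ler_sum_nat => d; rewrite ltnS => dn; have /andP[d_gt0 _] := dn.
have [y_ge1 yx xy] := natr_divn_bounds dn.
have nd_gt0 : (0 < n %/ d)%N by rewrite -(ler1n R).
have /andP[S_ge S_le] : c - (n %/ d)%:R^-1 <= S (n %/ d)%N <= c := sum_inv_sqr_bounds R nd_gt0.
have d0 : 0 < d%:R :> R by rewrite ltr0n.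
have n0 : 0 < n%:R :> R by rewrite ltr0n.
have -> : c * ((mobius d)%:~R / d%:R ^+ 2) - S (n %/ d)%N / d%:R ^+ 2 * (mobius d)%:~R
   = (c - S (n %/ d)%N) / d%:R ^+ 2 * (mobius d)%:~R by ring.
rewrite normrM (le_trans (ler_piMr _ (norm_mobius_intr_le1 d))) //.
have cS : 0 <= c - S (n %/ d)%N <= (n %/ d)%:R^-1 by apply/andP; split; lra.
have /andP[cS0 cS1] := cS.
rewrite ger0_norm ?divr_ge0 ?exprn_ge0 //.
rewrite ler_pdivrMr ?exprn_gt0 //.
have -> : 2 / n%:R / d%:R * d%:R ^+ 2 = 2 / (n%:R / d%:R) :> R.
  by field; rewrite !gt_eqF.
apply: (le_trans cS1).
have x_gt0 : 0 < n%:R / d%:R :> R by rewrite divr_gt0.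
(* The factor 2: the floor [y] of [x] is at least 1 and exceeds [x - 1], so [x <= 2 * y]. *)
rewrite ler_pdivlMr // mulrC ler_pdivrMr; lra.
Qed.

(** In [totient_sum_mobius], dropping the floors costs [n / 2] times the harmonic sum; replacing the
    Moebius sum [M] by [c^-1] costs [n] times it. *)
Lemma totient_sum_asymp n : (0 < n)%N ->
  `|totient_sum n - 3 / pi ^+ 2 * n%:R ^+ 2| <= 3 / 2 * n%:R * harmonic_sum n.
Proof.
move=> n_gt0; have n0 : 0 < n%:R :> R by rewrite ltr0n.
have c_ge1 : 1 <= c.
  by have /andP[_] := sum_inv_sqr_bounds R (ltn0Sn 0); rewrite big_nat1 expr1n invr1.
have pi0 : 0 < pi :> R by exact: pi_gt0.
have inv2c (p : R) : 0 < p -> 3 / p ^+ 2 = (2 * (p ^+ 2 / 6))^-1.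
  by move=> p_gt0; field; rewrite gt_eqF.
rewrite (inv2c _ pi0) -/c.
set M : R := \sum_(1 <= d < n.+1) (mobius d)%:~R / d%:R ^+ 2.
have h1 : `|totient_sum n - n%:R ^+ 2 / 2 * M| <= n%:R / 2 * harmonic_sum n.
  rewrite totient_sum_mobius // mulr_sumr -sumrB mulr_sumr.
  rewrite (le_trans (ler_norm_sum _ _ _)) //.
  apply: ler_sum_nat => d; rewrite ltnS => dn; have /andP[d_gt0 _] := dn.
  have [] := natr_divn_bounds dn.
  have d0 : 0 < d%:R :> R by rewrite ltr0n.
  have -> : n%:R / 2 / d%:R = n%:R / d%:R / 2 :> R by ring.
  have -> : n%:R ^+ 2 / 2 * ((mobius d)%:~R / d%:R ^+ 2)
     = (n%:R / d%:R) ^+ 2 / 2 * (mobius d)%:~R :> R by field; rewrite gt_eqF.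
  move: (n%:R / d%:R : R) ((n %/ d)%:R : R) => x y y_ge1 yx xy.
  rewrite -mulrBl normrM (le_trans (ler_piMr _ (norm_mobius_intr_le1 d))) //.
  (* With [y <= x < y + 1], the numbers [y * (y + 1)] and [x ^+ 2] differ by at most [x]. *)
  rewrite ler_norml; apply/andP; split; nra.
have h2 := mobius_sum_inv_sqr n_gt0; rewrite -/M in h2.
have -> : totient_sum n - (2 * c)^-1 * n%:R ^+ 2
   = (totient_sum n - n%:R ^+ 2 / 2 * M) + n%:R ^+ 2 / 2 / c * (c * M - 1).
  by field; rewrite gt_eqF //; lra.
rewrite (le_trans (ler_normD _ _)) //.
have h3 : `|n%:R ^+ 2 / 2 / c * (c * M - 1)| <= n%:R * harmonic_sum n.
  rewrite normrM ger0_norm; last by rewrite !divr_ge0 ?exprn_ge0 //; lra.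
  apply: (@le_trans _ _ (n%:R ^+ 2 / 2 * (2 / n%:R * harmonic_sum n))).
    apply: ler_pM => //; first by rewrite !divr_ge0 ?exprn_ge0 //; lra.
    by rewrite ler_pdivrMr ?ler_peMr ?divr_ge0 ?exprn_ge0 //; lra.
  by rewrite le_eqVlt; apply/orP; left; apply/eqP; field; rewrite gt_eqF.
lra.
Qed.

End Asymptotics.

(** * The dilogarithm and the main estimate *)

Section Main.
Variable R : realType.

(** In the tail [z ^+ k <= z]. Keeping this factor [z] in the error allows the later division by
    [1 - alpha], uniformly as [alpha] tends to 1. *)
Lemma Li2_bounds (z : R) n : 0 <= z <= 1 -> (0 < n)%N ->
  \sum_(1 <= k < n.+1) z ^+ k / k%:R ^+ 2 <= Li2 z
  <= \sum_(1 <= k < n.+1) z ^+ k / k%:R ^+ 2 + z / n%:R.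
Proof.
move=> /andP[z_ge0 z_le1] n_gt0.
pose u (N : nat) : R := \sum_(1 <= k < N) z ^+ k / k%:R ^+ 2.
have term_ge0 k : 0 <= z ^+ k / k%:R ^+ 2 by rewrite divr_ge0 ?exprn_ge0.
have u_ndecr : nondecreasing_seq u.
  move=> a b ab; rewrite /u; have [a_gt0|] := ltnP 0 a.
    by rewrite [leRHS](@big_cat_nat _ _ _ a) //= lerDl sumr_ge0.
  by rewrite leqn0 => /eqP ->; rewrite big_geq // sumr_ge0.
have u_le N : u N <= u n.+1 + z / n%:R.
  have [Nn|nN] := leqP N n.+1.
    by rewrite (le_trans (u_ndecr _ _ Nn)) // lerDl divr_ge0.
  rewrite {1}/u (@big_cat_nat _ _ _ n.+1) //=; last exact: ltnW.
  rewrite lerD2l; apply: (@le_trans _ _ (z * \sum_(n.+1 <= k < N) (k%:R ^+ 2)^-1)).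
    rewrite mulr_sumr; apply: ler_sum_nat => k /andP[nk _].
    rewrite ler_wpM2r ?invr_ge0 ?exprn_ge0 //.
    by rewrite -[leRHS]expr1 ler_wiXn2l // (leq_trans _ nk).
  by rewrite ler_wpM2l // sum_inv_sqr_tail_le.
have u_bounded : has_ubound (range u).
  by exists (u n.+1 + z / n%:R) => _ [N _ <-].
have u_cvg := nondecreasing_is_cvgn u_ndecr u_bounded.
rewrite /Li2 -/u.
apply/andP; split; first exact: nondecreasing_cvgn_le.
by apply: limr_le => //; apply: nearW.
Qed.

Lemma sum_expr_pred (z : R) k :
  (1 - z) * \sum_(1 <= j < k.+1) z ^+ j.-1 = 1 - z ^+ k.
Proof.
by rewrite big_add1 /= big_mkord -opprB mulNr -subrX1 opprB.
Qed.

Lemma dens_factor_approx (alpha : R) n : 0 <= alpha <= 1 -> (0 < n)%N ->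
  `|dens_factor alpha - alpha * \sum_(1 <= j < n.+1) (1 - alpha) ^+ j.-1 / j%:R ^+ 2|
  <= alpha / n%:R.
Proof.
move=> /andP[a_ge0 a_le1] n_gt0; rewrite /dens_factor.
case: eqP => [->|/eqP a_neq1].
  (* At [alpha = 1] only [j = 1] survives, with [0 ^+ 0 = 1], matching the convention in
     [dens_factor]. *)
  rewrite subrr mul1r big_ltn // big_nat big1 => [|j /andP[j_gt1 _]].
    by rewrite addr0 expr0 expr1n divr1 subrr normr0 divr_ge0.
  by case: j j_gt1 => [|[|j]] // _; rewrite expr0n /= mul0r.
have a_lt1 : alpha < 1 by rewrite lt_neqAle a_neq1.
have z_bounds : 0 <= 1 - alpha <= 1 by apply/andP; split; lra.
have z_gt0 : 0 < 1 - alpha by lra.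
have := Li2_bounds z_bounds n_gt0.
move: (1 - alpha) z_gt0 (Li2 _) => z z_gt0 L.
have -> : \sum_(1 <= k < n.+1) z ^+ k / k%:R ^+ 2
    = z * \sum_(1 <= j < n.+1) z ^+ j.-1 / j%:R ^+ 2.
  rewrite mulr_sumr; apply: eq_big_nat => k /andP[k_gt0 _].
  by rewrite mulrA -exprS prednK.
move: (\sum_(1 <= j < n.+1) _) => S /andP[L_ge L_le].
have -> : alpha * L / z - alpha * S = alpha * ((L - z * S) / z).
  by field; rewrite gt_eqF.
rewrite normrM ger0_norm // ler_wpM2l // ger0_norm; last by rewrite divr_ge0 ?(ltW z_gt0) ?subr_ge0.
by rewrite ler_pdivrMr // mulrC; lra.
Qed.

(** Three errors, in units of [alpha * n%:R * H ^+ 2]: at most 1 from the added term [d = 1], 5/2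
    from the totient sums, and 1/2 from the tail of [Li2]. *)
Lemma expected_deg_lcm_approx n (alpha : R) : (0 < n)%N -> 0 <= alpha <= 1 ->
  `|expected_deg_lcm n alpha - 3 / pi ^+ 2 * dens_factor alpha * n%:R ^+ 2|
  <= 4 * alpha * n%:R * harmonic_sum R n ^+ 2.
Proof.
move=> n_gt0 a01; have /andP[a_ge0 a_le1] := a01.
have n0 : 0 < n%:R :> R by rewrite ltr0n.
set z := 1 - alpha; set c : R := 3 / pi ^+ 2; set H := harmonic_sum R n.
have z01 : 0 <= z <= 1 by rewrite /z; apply/andP; split; lra.
have /andP[z_ge0 z_le1] := z01.
have H_ge1 : 1 <= H by exact: harmonic_sum_ge1.
have c_gt0 : 0 < c by rewrite divr_gt0 // exprn_gt0 // pi_gt0.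
(* The first term of the series of inverse squares already gives [6 <= pi ^+ 2]. *)
have c_le : c <= 1 / 2.
  have /andP[_] := sum_inv_sqr_bounds R (ltn0Sn 0).
  rewrite big_nat1 expr1n invr1 ler_pdivrMr ?exprn_gt0 ?pi_gt0 // => pi_ge.
  lra.
have one_sub k : 1 - z ^+ k = alpha * \sum_(1 <= j < k.+1) z ^+ j.-1.
  by rewrite -sum_expr_pred /z; congr (_ * _); ring.
have E1 : expected_deg_lcm n alpha + (1 - z ^+ n)
    = alpha * \sum_(1 <= j < n.+1) z ^+ j.-1 * totient_sum R (n %/ j)%N.
  rewrite expected_deg_lcmE addrC.
  transitivity (\sum_(1 <= d < n.+1) (totient d)%:R * (1 - z ^+ (n %/ d))).
    by rewrite [RHS]big_ltn // divn1 mul1r.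
  rewrite mulr_sumr.
  transitivity (\sum_(1 <= d < n.+1) \sum_(1 <= j < (n %/ d).+1)
     alpha * z ^+ j.-1 * (totient d)%:R).
    apply: eq_bigr => d _; rewrite one_sub mulrC -mulr_suml -mulr_sumr //.
  rewrite sum_hyperbola_swap; apply: eq_bigr => j _.
  by rewrite mulrA -mulr_sumr /totient_sum natr_sum.
pose T : R := \sum_(1 <= j < n.+1) z ^+ j.-1 / j%:R ^+ 2.
have err1 : 0 <= 1 - z ^+ n <= alpha * n%:R.
  rewrite subr_ge0 exprn_ile1 //= one_sub ler_wpM2l //.
  apply: (@le_trans _ _ (\sum_(1 <= j < n.+1) 1)).
    by apply: ler_sum => j _; rewrite exprn_ile1.
  by rewrite sumr_const_nat subSS subn0.
(* Here 5/2 is 3/2 from [totient_sum_asymp] at [n %/ j], plus 1 from replacing [n %/ j] by the real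
   quotient. The sum of [j%:R^-1] yields the second factor [H]. *)
have err2 : `|\sum_(1 <= j < n.+1) z ^+ j.-1 * totient_sum R (n %/ j)%N
    - c * n%:R ^+ 2 * T| <= 5 / 2 * n%:R * H ^+ 2.
  rewrite /T mulr_sumr -sumrB (le_trans (ler_norm_sum _ _ _)) //.
  have -> : 5 / 2 * n%:R * H ^+ 2 = \sum_(1 <= j < n.+1) 5 / 2 * n%:R * H / j%:R.
    by rewrite -mulr_sumr expr2 mulrA.
  apply: ler_sum_nat => j; rewrite ltnS => jn; have /andP[j_gt0 _] := jn.
  have [y_ge1 yx xy] := natr_divn_bounds R jn.
  have d_gt0 : (0 < n %/ j)%N by rewrite -(ler1n R).
  have asymp := totient_sum_asymp R d_gt0.
  have Hle : harmonic_sum R (n %/ j) <= H by rewrite harmonic_sum_le // leq_div.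
  have j0 : 0 < j%:R :> R by rewrite ltr0n.
  have -> : c * n%:R ^+ 2 * (z ^+ j.-1 / j%:R ^+ 2)
     = z ^+ j.-1 * (c * (n%:R / j%:R) ^+ 2) by field; rewrite gt_eqF.
  have -> : 5 / 2 * n%:R * H / j%:R = 5 / 2 * (n%:R / j%:R) * H by ring.
  rewrite -mulrBr normrM ger0_norm ?exprn_ge0 //.
  rewrite (le_trans (ler_piMl _ (exprn_ile1 _ _ _))) //.
  rewrite -/c in asymp.
  move: (harmonic_sum_ge1 R d_gt0).
  move: asymp Hle yx xy y_ge1; move: (totient_sum R _) (harmonic_sum R (n %/ j)).
  move: (n%:R / j%:R : R) ((n %/ j)%:R : R) => x y P h asymp Hle yx xy y_ge1 h_ge1.
  have step1 : `|P - c * y ^+ 2| <= 3 / 2 * x * H.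
    apply: (le_trans asymp); rewrite ler_pM //; lra.
  have step2 : `|c * y ^+ 2 - c * x ^+ 2| <= x * H.
    rewrite -mulrBr normrM ger0_norm ?(ltW c_gt0) //.
    apply: (@le_trans _ _ (1 / 2 * `|y ^+ 2 - x ^+ 2|)); first by rewrite ler_wpM2r.
    have sqr_le : x ^+ 2 - y ^+ 2 <= 2 * x.
      apply: (@le_trans _ _ (x + y)); last by lra.
      by rewrite subr_sqr ler_piMl //; lra.
    have xH : x <= x * H by rewrite ler_peMr //; lra.
    rewrite distrC ger0_norm; last by rewrite subr_sqr mulr_ge0 //; lra.
    lra.
  have -> : P - c * x ^+ 2 = (P - c * y ^+ 2) + (c * y ^+ 2 - c * x ^+ 2) by ring.
  by rewrite (le_trans (ler_normD _ _)) //; lra.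
have err3 := dens_factor_approx a01 n_gt0; rewrite -/z -/T in err3.
set E := expected_deg_lcm n alpha in E1 *.
set Q := \sum_(1 <= j < n.+1) z ^+ j.-1 * totient_sum R (n %/ j)%N in E1 err2.
set D := dens_factor alpha in err3 *.
have -> : E - c * D * n%:R ^+ 2
    = - (1 - z ^+ n) + alpha * (Q - c * n%:R ^+ 2 * T)
      + c * n%:R ^+ 2 * (alpha * T - D).
  by rewrite !mulrBr -E1; ring.
have bound2 : `|alpha * (Q - c * n%:R ^+ 2 * T)|
    <= 5 / 2 * (alpha * n%:R * H ^+ 2).
  rewrite normrM ger0_norm // (le_trans (ler_wpM2l a_ge0 err2)) //.
  by rewrite le_eqVlt; apply/orP; left; apply/eqP; ring.
have bound3 : `|c * n%:R ^+ 2 * (alpha * T - D)| <= c * (alpha * n%:R).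
  have cn_ge0 : 0 <= c * n%:R ^+ 2 by rewrite mulr_ge0 ?exprn_ge0 ?(ltW c_gt0).
  rewrite normrM (ger0_norm cn_ge0) distrC -mulrA.
  rewrite ler_pM2l // (le_trans (ler_wpM2l _ err3)) ?exprn_ge0 //.
  by rewrite le_eqVlt; apply/orP; left; apply/eqP; field; rewrite gt_eqF.
have an_ge0 : 0 <= alpha * n%:R by rewrite mulr_ge0.
have anH : alpha * n%:R <= alpha * n%:R * H ^+ 2.
  by rewrite ler_peMr // exprn_ege1.
have c_an : c * (alpha * n%:R) <= 1 / 2 * (alpha * n%:R) by rewrite ler_wpM2r.
rewrite (le_trans (ler_normD _ _)) // (le_trans (lerD (ler_normD _ _) (lexx _))) //.
have /andP[err1_ge0 err1_le] := err1.
rewrite normrN (ger0_norm err1_ge0) -!mulrA [4 * _]mulrA.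
move: bound2 bound3 anH c_an err1_le; rewrite -!mulrA.
lra.
Qed.

End Main.

Theorem theorem1p2 (R : realType) :
  exists C : R, 0 < C /\
    forall (n : nat) (alpha : R), (2 <= n)%N -> 0 <= alpha <= 1 ->
      `| expected_deg_lcm n alpha
         - 3 / pi ^+ 2 * dens_factor alpha * (n%:R) ^+ 2 |
      <= C * alpha * n%:R * (ln (n%:R : R)) ^+ 2.
Proof.
have ln2_gt0 : 0 < ln 2 :> R by rewrite ln_gt0 // ltr1n.
(* For [n >= 2] the 1 in [1 + ln n] is at most [ln n / ln 2]; the bound on the harmonic sum is then
   squared. *)
exists (4 * ((ln 2)^-1 + 1) ^+ 2); split.
  by rewrite mulr_gt0 // exprn_gt0 // addr_gt0 // invr_gt0.
move=> n alpha n_ge2 a01; have n_gt0 : (0 < n)%N by exact: ltnW.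
have /andP[a_ge0 _] := a01.
apply: (le_trans (expected_deg_lcm_approx n_gt0 a01)).
have le_H : harmonic_sum R n <= ((ln 2)^-1 + 1) * ln n%:R.
  apply: (le_trans (harmonic_sum_le_ln R n_gt0)).
  rewrite mulrDl mul1r lerD2r mulrC ler_pdivlMr // mul1r ler_ln ?posrE ?ltr0n //.
  by rewrite ler_nat.
have -> : 4 * ((ln 2)^-1 + 1) ^+ 2 * alpha * n%:R * ln n%:R ^+ 2
  = 4 * alpha * n%:R * (((ln 2)^-1 + 1) * ln n%:R) ^+ 2 :> R by ring.
rewrite ler_wpM2l ?mulr_ge0 // ler_pXn2r ?nnegrE //.
  by rewrite (le_trans ler01) // harmonic_sum_ge1.
by rewrite (le_trans _ le_H) // (le_trans ler01) // harmonic_sum_ge1.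
Qed.
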